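(* Let $(G,\otimes)$ be a strictly o-bounded $T_0$ topological group, and let $(H,\triangle)$ be a $T_0$ topological group with the property $\mathsf{S}_{fin}(\mathcal{O}_{nbd},\mathcal{O})$. Then the product group $G\times H$ (with the product topology) has the property $\mathsf{S}_{fin}(\mathcal{O}_{nbd},\mathcal{O})$.
   Context: For a topological group $(G,\otimes)$ with identity $id$, $x\otimes S=\{x\otimes g:g\in S\}$ and $S\otimes T=\{x\otimes y:x\in S,\ y\in T\}$. $\mathcal{O}$ is the collection of all open covers of $G$. For an (open) neighborhood $U$ of $id$ let $\mathcal{O}(U)=\{x\otimes U:x\in G\}$ and $\Omega(U)=\{F\otimes U: F\subset G\text{ finite}\}$; $\mathcal{O}_{nbd}$ is the collection of all $\mathcal{O}(U)$ and $\Omega_{nbd}$ is the collection of all $\Omega(U)$, with $U$ ranging over the neighborhoods of $id$. $\mathsf{S}_{fin}(\mathcal{A},\mathcal{B})$: for each sequence $(A_n:n\in\mathbb{N})$ of members of $\mathcal{A}$ there is a sequence $(B_n:n\in\mathbb{N})$ such that each $B_n$ is a finite subset of $A_n$ and $\bigcup\{B_n:n\in\mathbb{N}\}\in\mathcal{B}$. The families are computed in the group under consideration. The game $\mathsf{G}_1(\mathcal{A},\mathcal{B})$: players ONE and TWO play an inning for each positive integer $n$; in inning $n$ ONE first chooses $A_n\in\mathcal{A}$, and TWO responds with $B_n\in A_n$. TWO wins the play if $\{B_n:n\in\mathbb{N}\}\in\mathcal{B}$; otherwise ONE wins. A topological group is strictly o-bounded if TWO has a winning strategy in the game $\mathsf{G}_1(\Omega_{nbd},\mathcal{O})$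 played on it. *)

(* Defs.v *)
From HB Require Import structures.
From mathcomp Require Import all_boot.
From mathcomp Require Import boolp classical_sets functions cardinality.
From mathcomp Require Import topology.

Set Implicit Arguments.
Unset Strict Implicit.
Unset Printing Implicit Defensive.

Local Open Scope classical_set_scope.
Local Open Scope group_scope.

HB.mixin Record Group_isTopologicalGroup G of Group G & Topological G := {
  mulg_continuous : continuous (fun p : G * G => p.1 * p.2);
  invg_continuous : continuous (fun x : G => x^-1);
}.

#[short(type="topologicalGroupType")]
HB.structure Definition TopologicalGroup :=
  {G of Group_isTopologicalGroup G & Group G & Topological G}.

Section ProductTopologicalGroup.
Variables G H : topologicalGroupType.

Lemma prod_mulg_continuous :
  continuous (fun p : (G * H) * (G * H) => p.1 * p.2).
Proof.
move=> [[x1 y1] [x2 y2]].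
apply: (cvg_pair (G := nbhs (x1 * x2)) (H := nbhs (y1 * y2))
  (f := fun p => p.1.1 * p.2.1) (g := fun p => p.1.2 * p.2.2)).
- apply: (@cvg_comp _ _ _ (fun p : (G * H) * (G * H) => (p.1.1, p.2.1))
    (fun p : G * G => p.1 * p.2) _ (nbhs (x1, x2))); last exact: (mulg_continuous (_, _)).
  apply: (cvg_pair (G := nbhs x1) (H := nbhs x2)
    (f := fst \o fst) (g := fst \o snd)).
    by apply: cvg_comp; [exact: cvg_fst|exact: cvg_fst].
  by apply: cvg_comp; [exact: cvg_snd|exact: cvg_fst].
- apply: (@cvg_comp _ _ _ (fun p : (G * H) * (G * H) => (p.1.2, p.2.2))
    (fun p : H * H => p.1 * p.2) _ (nbhs (y1, y2))); last exact: (mulg_continuous (_, _)).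
  apply: (cvg_pair (G := nbhs y1) (H := nbhs y2)
    (f := snd \o fst) (g := snd \o snd)).
    by apply: cvg_comp; [exact: cvg_fst|exact: cvg_snd].
  by apply: cvg_comp; [exact: cvg_snd|exact: cvg_snd].
Qed.

Lemma prod_invg_continuous : continuous (fun p : G * H => p^-1).
Proof.
move=> [x y].
apply: (cvg_pair (G := nbhs x^-1) (H := nbhs y^-1)
  (f := fun p => p.1^-1) (g := fun p => p.2^-1)).
- apply: (@cvg_comp _ _ _ fst (fun z : G => z^-1) _ (nbhs x)).
    exact: cvg_fst.
  exact: invg_continuous.
- apply: (@cvg_comp _ _ _ snd (fun z : H => z^-1) _ (nbhs y)).
    exact: cvg_snd.
  exact: invg_continuous.
Qed.

HB.instance Definition _ := Group_isTopologicalGroup.Build (G * H)%type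
  prod_mulg_continuous prod_invg_continuous.

End ProductTopologicalGroup.

Definition open_covers (T : topologicalType) : set (set (set T)) :=
  [set C | (forall V, C V -> open V) /\ \bigcup_(V in C) V = [set: T]].

Section NeighborhoodCovers.
Variable G : topologicalGroupType.
Implicit Types (x : G) (S T U : set G).

Definition lmul_set x S : set G := [set x * g | g in S].

Definition mul_set S T : set G := [set x * y | x in S & y in T].

Definition translates U : set (set G) := [set lmul_set x U | x in [set: G]].

Definition finite_translates U : set (set G) :=
  [set mul_set F U | F in [set F : set G | finite_set F]].

Definition nbd_covers : set (set (set G)) :=
  [set translates U | U in open_nbhs (1 : G)].

Definition nbd_omega_covers : set (set (set G)) :=
  [set finite_translates U | U in open_nbhs (1 : G)].

End NeighborhoodCovers.

Arguments open_covers : clear implicits.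
Arguments nbd_covers : clear implicits.
Arguments nbd_omega_covers : clear implicits.

Section SelectionPrinciples.
Variable T : Type.
Implicit Types A B : set (set (set T)).

Definition S_fin A B : Prop :=
  forall a : nat -> set (set T), (forall n, A (a n)) ->
  exists b : nat -> set (set T),
    (forall n, finite_set (b n) /\ b n `<=` a n) /\ B (\bigcup_n b n).

(* A strategy for TWO maps the nonempty finite sequence of the moves made so
   far by ONE to TWO's next move; [mkseq a n.+1] is [:: a 0; ...; a n], with
   innings numbered from 0. *)
Definition two_response (sigma : seq (set (set T)) -> set T)
    (a : nat -> set (set T)) : nat -> set T :=
  fun n => sigma (mkseq a n.+1).

Definition two_wins_G1 A B : Prop :=
  exists sigma : seq (set (set T)) -> set T,
    forall a : nat -> set (set T), (forall n, A (a n)) ->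
      (forall n, a n (two_response sigma a n)) /\
      B (range (two_response sigma a)).

End SelectionPrinciples.

Definition strictly_o_bounded (G : topologicalGroupType) : Prop :=
  two_wins_G1 (nbd_omega_covers G) (open_covers G).

(* Main.v *)
Require Import Defs.
From HB Require Import structures.
From mathcomp Require Import all_boot.
From mathcomp Require Import boolp classical_sets functions cardinality.
From mathcomp Require Import topology.

(** The theorem combines a covering property of G that holds eventually with a
    covering property of H that holds infinitely often.

    Fix neighborhoods [U n] of the identity of G and a winning strategy for
    TWO.  A position in which ONE has played only neighborhoods from this list
    is coded by the finite sequence of their indices, so there are countably
    many positions [s].  Let [K s] be the set of points that TWO covers from
    position [s] whatever index ONE plays next.  A point outside all the [K s]
    would let ONE win by always playing an index whose answer misses it; hence
    the [K s] cover G ([winning_strategy_cover]).  Each [K s] lies, for every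
    [n], in finitely many translates of [U n], so treating the first [n] of the
    [K s] at step [n] gives finite sets [F n] such that each point of G lies in
    [F n * U n] for all large [n] ([strictly_o_bounded_eventually]).

    On the side of H, applying the selection principle to every tail of a
    sequence [V n] gives finite sets [E n] such that each point of H lies in
    [E n * V n] for infinitely many [n] ([S_fin_nbd_infinitely_often]).

    If the box [U n `*` V n] is inside the given neighborhood [W n] of the
    identity of the product, each [(x, y)] therefore lies in
    [(F n `*` E n) * W n] for some [n]. *)

Set Implicit Arguments.
Unset Strict Implicit.
Unset Printing Implicit Defensive.

Local Open Scope classical_set_scope.
Local Open Scope group_scope.

(** [K s] is the intersection of TWO's answers to all one-move extensions of
    the position [s].  Legality of TWO's moves bounds [K s] by a member of each
    [a n]; and if every [K s] missed [x], ONE could reply to each position with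
    an index whose answer misses [x], against the strategy being winning. *)
Lemma winning_strategy_cover (T : topologicalType) (A : set (set (set T)))
    (a : nat -> set (set T)) :
  two_wins_G1 A (open_covers T) -> (forall n, A (a n)) ->
  exists K : seq nat -> set T,
    (forall s n, exists2 V, a n V & K s `<=` V) /\ (forall x, exists s, K s x).
Proof.
move=> [sigma win] Aa.
pose answer s n := sigma (rcons (map a s) (a n)).
exists (fun s => \bigcap_n answer s n); split=> [s n|x].
  exists (answer s n); last by move=> x; apply.
  (* The position [s] occurs in the play where ONE repeats [n] after [s]. *)
  have [legal _] := win (fun i => a (nth n s i)) (fun i => Aa _).
  have := legal (size s); rewrite /two_response mkseqS nth_default//.
  by rewrite /mkseq (map_comp a) -/(mkseq _ _) mkseq_nth.
apply: contrapT => /forallNP out_K.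
have /choice[f f_out] : forall s, exists n, ~ answer s n x.
  by move=> s; apply/existsNP => in_K; apply: (out_K s) => n _; exact: in_K.
pose pos n := iter n (fun s => rcons s (f s)) [::].
pose t n := f (pos n).
have posE n : mkseq t n = pos n by elim: n => // n IHn; rewrite mkseqS IHn.
have [_ [_ cov]] := win (a \o t) (fun n => Aa _).
have : [set: T] x by [].
rewrite -cov => -[V [n _ <-]].
rewrite /two_response mkseqS /mkseq (map_comp a) -/(mkseq t n) posE.
exact: f_out.
Qed.

Section GroupCovers.
Variable G : topologicalGroupType.
Implicit Types (x : G) (U : set G).

Lemma open_lmul_set x U : open U -> open (lmul_set x U).
Proof.
move=> Uopen.
have -> : lmul_set x U = (fun y => x^-1 * y) @^-1` U.
  apply/seteqP; split=> [_ [g Ug <-]|y Uy] /=; first by rewrite mulKg.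
  by exists (x^-1 * y) => //; rewrite mulVKg.
apply: open_comp => // y _.
apply: (@cvg_comp _ _ _ (fun y : G => (x^-1, y)) (fun p : G * G => p.1 * p.2)
   _ (nbhs (x^-1, y))); last exact: (mulg_continuous (_, _)).
by apply: cvg_pair; [exact: cvg_cst|exact: cvg_id].
Qed.

(** Every point is eventually covered because the [i]-th set [K s] is taken
    care of at all steps after [i]. *)
Lemma strictly_o_bounded_eventually (U : nat -> set G) :
  strictly_o_bounded G -> (forall n, open_nbhs (1 : G) (U n)) ->
  exists F : nat -> set G, (forall n, finite_set (F n)) /\
    forall x, exists N, forall n, (N <= n)%N -> mul_set (F n) (U n) x.
Proof.
move=> sob Unbd.
have [|K [Kbounded Kcover]] :=
  @winning_strategy_cover _ _ (fun n => finite_translates (U n)) sob.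
  by move=> n; exists (U n).
have /choice[E EP] : forall sn : seq nat * nat, exists E : set G,
    finite_set E /\ K sn.1 `<=` mul_set E (U sn.2).
  move=> [s n]; have [_ [E Efin <-] KE] := Kbounded s n.
  by exists E.
pose F n := \bigcup_(i in `I_n) E (odflt [::] (unpickle i), n).
exists F; split=> [n|x].
  by apply: bigcup_finite => [|i _]; [exact: finite_II|exact: (EP _).1].
have [s Ksx] := Kcover x.
exists (pickle s).+1 => n lt_sn.
have [g Eg [u Uu gu]] := (EP (s, n)).2 _ Ksx.
by exists g; [exists (pickle s); [exact: lt_sn|rewrite pickleK]|exists u].
Qed.

(** The set selected at step [n] collects the [(n - m)]-th selection for the
    tail starting at [m], for all [m <= n]; the tail starting at [m] then
    covers each point at some step that is at least [m]. *)
Lemma S_fin_nbd_infinitely_often (V : nat -> set G) :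
  S_fin (nbd_covers G) (open_covers G) ->
  (forall n, open_nbhs (1 : G) (V n)) ->
  exists E : nat -> set G, (forall n, finite_set (E n)) /\
    forall y m, exists2 n, (m <= n)%N & mul_set (E n) (V n) y.
Proof.
move=> Sfin Vnbd.
have /choice[D DP] : forall m, exists D : nat -> set G,
    (forall k, finite_set (D k)) /\
    forall y, exists k, mul_set (D k) (V (m + k)%N) y.
  move=> m; have [|b [bP [_ bcover]]] := Sfin (fun k => translates (V (m + k)%N)).
    by move=> k; exists (V (m + k)%N).
  (* A translate does not determine its center, so one is chosen. *)
  have /choice[c cP] : forall kB : nat * set G, exists x,
      translates (V (m + kB.1)%N) kB.2 -> lmul_set x (V (m + kB.1)%N) = kB.2.
    move=> [k B] /=; have [[x _ xB]|nB] := pselect (translates (V (m + k)%N) B).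
      by exists x.
    by exists 1.
  exists (fun k => [set c (k, B) | B in b k]); split=> [k|y].
    by apply: finite_image; exact: (bP k).1.
  have : [set: G] y by [].
  rewrite -bcover => -[B [k _ bB] By].
  exists k; have cB := cP (k, B) ((bP k).2 _ bB).
  have [v Vv vy] : lmul_set (c (k, B)) (V (m + k)%N) y by rewrite cB.
  by exists (c (k, B)); [exists B|exists v].
exists (fun n => \bigcup_(m in `I_n.+1) D m (n - m)%N); split=> [n|y m].
  by apply: bigcup_finite => [|m _]; [exact: finite_II|exact: (DP m).1].
have [k [g Dg [v Vv gv]]] := (DP m).2 y.
exists (m + k)%N; first exact: leq_addr.
exists g; last by exists v.
by exists m => /=; [rewrite ltnS leq_addr|rewrite addKn].
Qed.

(** The principle asks for families of translates; it is enough to produce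
    their finite sets of centers. *)
Lemma S_fin_nbdI :
  (forall W : nat -> set G, (forall n, open_nbhs (1 : G) (W n)) ->
    exists P : nat -> set G, (forall n, finite_set (P n)) /\
      forall x, exists n, mul_set (P n) (W n) x) ->
  S_fin (nbd_covers G) (open_covers G).
Proof.
move=> centers a /(_ _)/cid2-/all_sig2[W Wnbd Wa].
have [P [Pfin Pcover]] := centers W Wnbd.
exists (fun n => [set lmul_set x (W n) | x in P n]); split=> [n|].
  by split; [exact: finite_image|rewrite -Wa => _ [x _ <-]; exists x].
split=> [_ [n _ [x _ <-]]|]; first by apply: open_lmul_set; exact: (Wnbd n).1.
apply/seteqP; split=> // x _.
have [n [p Pp [w Ww pw]]] := Pcover x.
by exists (lmul_set p (W n)); [exists n => //; exists p|exists w].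
Qed.

End GroupCovers.

Lemma open_nbhs_prod_box (S T : topologicalType) (x : S) (y : T)
    (W : set (S * T)) : open_nbhs (x, y) W ->
  exists U V, [/\ open_nbhs x U, open_nbhs y V & U `*` V `<=` W].
Proof.
move=> /open_nbhs_nbhs[[A B] /= [xA yB] ABW].
move: xA yB; rewrite !nbhsE => -[U xU UA] [V yV VB].
by exists U, V; split=> // p [Up Vp]; apply: ABW; split; [exact: UA|exact: VB].
Qed.

Theorem corollary18 (G H : topologicalGroupType)
  (G_T0 : kolmogorov_space G) (H_T0 : kolmogorov_space H)
  (G_sob : strictly_o_bounded G)
  (H_Sfin : S_fin (nbd_covers H) (open_covers H)) :
  S_fin (nbd_covers (G * H)%type) (open_covers (G * H)%type).
Proof.
apply: S_fin_nbdI => W Wnbd.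
have /choice[U /choice[V box]] := fun n => open_nbhs_prod_box (Wnbd n).
have [|F [Ffin Fcover]] := @strictly_o_bounded_eventually _ U G_sob.
  by move=> n; have [] := box n.
have [|E [Efin Ecover]] := @S_fin_nbd_infinitely_often _ V H_Sfin.
  by move=> n; have [] := box n.
exists (fun n => F n `*` E n); split=> [n|[x y]]; first exact: finite_setX.
have [N xcov] := Fcover x.
have [n le_Nn [h Eh [v Vv hv]]] := Ecover y N.
have [g Fg [u Uu gu]] := xcov n le_Nn.
have [_ _ UVW] := box n.
exists n, (g, h) => //; exists (u, v); first exact: UVW.
by rewrite -gu -hv.
Qed.
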